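(* Let $(\mathsf{E},\mathcal{F},\mu)$ be a probability space and let $P_{1},P_{2}$ be $\mu$-invariant Markov kernels on $\mathsf{E}$. Assume there is a measurable $\varepsilon:\mathsf{E}^{2}\to(0,\infty)$ such that for all $(x,A)\in\mathsf{E}\times\mathcal{F}$, \[ P_{2}(x,A\setminus\{x\})\ge\int_{A\setminus\{x\}}\varepsilon(x,y)P_{1}(x,\mathrm{d}y). \] Let $p\in(1,\infty]$ and $q\ge1$ with $p^{-1}+q^{-1}=1$, and for $s>0$ let $A(s):=\{(x,y)\in\mathsf{E}^{2}:s\,\varepsilon(x,y)>1\}$. Then for every $s>0$ and every $f\in\mathrm{L}_{0}^{2p}(\mu)$, \[ \mathcal{E}(P_{1},f)\le s\,\mathcal{E}(P_{2},f)+\mu\otimes P_{1}\big(A(s)^{\complement}\cap\{X\neq Y\}\big)^{1/q}\,\Phi_{p}(f), \] where $\Phi_{p}(f):=4\|f\|_{2p}^{2}$ if $p\in(1,\infty)$ and $\Phi_{\infty}(f):=\|f\|_{\mathrm{osc}}^{2}$.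
   Context: $\mathrm{L}^{r}(\mu)$ has norm $\|f\|_{r}=(\int|f|^{r}\mathrm{d}\mu)^{1/r}$, and $\mathrm{L}_{0}^{r}(\mu)$ consists of $f\in\mathrm{L}^{r}(\mu)$ with $\mu(f)=0$ (for $p=\infty$, $\mathrm{L}^{2p}$ means $\mathrm{L}^{\infty}$). $\|f\|_{\mathrm{osc}}:=\operatorname{ess\,sup}_{\mu}f-\operatorname{ess\,inf}_{\mu}f$. For a Markov kernel $P$, $\mathcal{E}(P,f):=\langle(\mathrm{Id}-P)f,f\rangle$ with the $\mathrm{L}^{2}(\mu)$ inner product, and $\mu\otimes P(B):=\int_{B}\mu(\mathrm{d}x)P(x,\mathrm{d}y)$ for measurable $B\subset\mathsf{E}^{2}$, with $(X,Y)$ denoting the coordinates on $\mathsf{E}^{2}$. *)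

(* Defs.v *)
From HB Require Import structures.
From mathcomp Require Import all_boot all_order all_algebra.
From mathcomp Require Import all_classical all_reals all_analysis.
From mathcomp Require Import ess_sup_inf hoelder kernel.
Set Implicit Arguments. Unset Strict Implicit. Unset Printing Implicit Defensive.
Import Order.TTheory GRing.Theory Num.Theory.
Import numFieldNormedType.Exports.
Local Open Scope classical_set_scope.
Local Open Scope ring_scope.

Definition kernel_invariant d (T : measurableType d) (R : realType)
  (mu : probability T R) (P : R.-pker T ~> T) : Prop :=
  forall A : set T, measurable A -> (\int[mu]_x P x A = mu A)%E.

Definition kapply d (T : measurableType d) (R : realType)
  (P : R.-pker T ~> T) (f : T -> R) (x : T) : R :=
  fine (\int[P x]_y (f y)%:E)%E.

Definition dirichlet d (T : measurableType d) (R : realType)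
  (mu : probability T R) (P : R.-pker T ~> T) (f : T -> R) : R :=
  fine (\int[mu]_x ((f x - kapply P f x) * f x)%:E)%E.

Definition mu_otimes d (T : measurableType d) (R : realType)
  (mu : probability T R) (P : R.-pker T ~> T) (B : set (T * T)) : \bar R :=
  (\int[mu]_x P x [set y | B (x, y)])%E.

Definition L0space d (T : measurableType d) (R : realType)
  (mu : probability T R) (r : \bar R) (f : T -> R) : Prop :=
  measurable_fun setT f /\ (Lnorm mu r (EFin \o f) < +oo)%E /\
  (\int[mu]_x (f x)%:E = 0)%E.

Definition Phi d (T : measurableType d) (R : realType)
  (mu : probability T R) (p : \bar R) (f : T -> R) : R :=
  if p is +oo%E then
    (fine (ess_sup mu (EFin \o f) - ess_inf mu (EFin \o f))%E) ^+ 2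
  else 4 * (fine (Lnorm mu (2%:E * p)%E (EFin \o f))) ^+ 2.

(* Main.v *)
Require Import Defs.
From HB Require Import structures.
From mathcomp Require Import all_boot all_order all_algebra.
From mathcomp Require Import all_classical all_reals all_analysis.
From mathcomp Require Import measurable_realfun ess_sup_inf hoelder kernel.
From mathcomp Require Import lra ring.
Import Order.TTheory GRing.Theory Num.Theory.
Import numFieldNormedType.Exports.
Local Open Scope classical_set_scope.
Local Open Scope ring_scope.

(** The symmetrised form of the Dirichlet form needs invariance only, not
    reversibility: [E(P, f)] is the integral of [h(x, y) = (f x - f y)^2 / 2]
    against [mu (x) P], because both marginals of that measure are [mu].  With [B]
    the off-diagonal part of the complement of [A(s)], the pointwise inequality
    [h <= s eps h + h 1_B] splits [E(P1, f)] in two.  The first part is at most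
    [s E(P2, f)], since [h] vanishes on the diagonal and [P2] dominates
    [eps P1] off it; the second is bounded by Hoelder's inequality when [p] is
    finite and by the essential oscillation of [f] when [p] is infinite. *)

(** * The law of one step of the chain started from [mu], with its Tonelli formula *)

Section joint_measure.
Context {d : measure_display} {T : measurableType d} {R : realType}.
Variables (mu : probability T R) (P : R.-pker T ~> T).
Local Open Scope ereal_scope.

Let triple_pair (z : (unit * T) * T) : T * T := (z.1.2, z.2).

Let measurable_triple_pair : measurable_fun [set: (unit * T) * T] triple_pair.
Proof.
by apply: measurable_fun_pair => //; apply: (measurableT_comp (f := snd)).
Qed.

(* The measure [mu (x) P] on [T * T]: kernel composition along [unit], with the
   Dirac kernel at [(x, y)] as last step, so that [integral_kcomp] yields Tonelli. *)
Definition joint : {measure set (T * T) -> \bar R} :=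
  (kprobability (measurable_cst (mu : pprobability T R)) \;
   (kernel.kernel_snd P \; kdirac measurable_triple_pair)) tt.

Lemma ge0_integral_joint (g : T * T -> \bar R) :
  measurable_fun [set: T * T] g -> (forall z, 0 <= g z) ->
  \int[joint]_z g z = \int[mu]_x \int[P x]_y g (x, y).
Proof.
move=> mg g0; rewrite /joint [LHS]integral_kcomp//.
apply: eq_integral => x _.
rewrite [LHS]integral_kcomp//; apply: eq_integral => y _.
by rewrite integral_dirac// diracT mul1e.
Qed.

End joint_measure.

(** * The two marginals of the joint law *)

Section marginals.
Context {d : measure_display} {T : measurableType d} {R : realType}.
Variables (mu : probability T R) (P : R.-pker T ~> T).
Local Open Scope ereal_scope.
Local Notation m := (joint mu P).

Lemma joint_xsection A : measurable A -> m A = \int[mu]_x P x (xsection A x).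
Proof.
move=> mA; rewrite -[in LHS](setIT A) -integral_indic// ge0_integral_joint//.
- by apply: eq_integral => x _; have /(congr1 (@^~ x)) := kfcompkindic P mA.
- exact/measurable_EFinP.
Qed.

Lemma ge0_integral_joint_fst (g : T -> \bar R) :
  measurable_fun [set: T] g -> (forall x, 0 <= g x) ->
  \int[m]_z g z.1 = \int[mu]_x g x.
Proof.
move=> mg g0; rewrite ge0_integral_joint//.
  apply: eq_integral => x _.
  have := integral_cst (P x) measurableT (g x).
  by rewrite prob_kernel mule1.
exact: measurableT_comp.
Qed.

Hypothesis invP : kernel_invariant mu P.

(** Invariance says that the pushforward of [joint] under [snd] agrees with [mu] on measurable sets;
    a change of variables does the rest. *)
Lemma ge0_integral_joint_snd (g : T -> \bar R) :
  measurable_fun [set: T] g -> (forall x, 0 <= g x) ->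
  \int[m]_z g z.2 = \int[mu]_x g x.
Proof.
move=> mg g0; rewrite -[LHS]/(\int[m]_(z in snd @^-1` setT) (g \o snd) z).
rewrite -ge0_integral_pushforward//.
apply: eq_measure_integral => A mA _.
have mA2 : measurable (snd @^-1` A : set (T * T)).
  by rewrite -[X in measurable X]setTI; exact: measurable_snd.
transitivity (\int[mu]_x P x (xsection (snd @^-1` A) x)).
  exact: joint_xsection.
transitivity (\int[mu]_x P x A); last exact: invP.
by apply: eq_integral => x _; rewrite xsectionE.
Qed.

End marginals.

(** * Fubini for signed functions and symmetrisation of the Dirichlet form *)

Section dirichlet_form.
Context {d : measure_display} {T : measurableType d} {R : realType}.
Variables (mu : probability T R) (P : R.-pker T ~> T).
Local Open Scope ereal_scope.
Local Notation m := (joint mu P).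

(** Used on positive and negative parts, so that the two outer integrals can be subtracted in the
    signed case. *)
Lemma ge0_integrable_integral_kernel (g : T * T -> \bar R) : (forall z, 0 <= g z) ->
  m.-integrable setT g -> mu.-integrable setT (fun x => \int[P x]_y g (x, y)).
Proof.
move=> g0 /integrableP[mg goo]; apply/integrableP; split.
  exact: measurable_fun_integral_finite_kernel.
move: goo; under eq_integral do rewrite gee0_abs//.
rewrite ge0_integral_joint//; apply: le_lt_trans.
by under eq_integral do rewrite gee0_abs ?integral_ge0//.
Qed.

Lemma integral_joint (g : T * T -> \bar R) : m.-integrable setT g ->
  \int[m]_z g z = \int[mu]_x \int[P x]_y g (x, y).
Proof.
move=> ig.
have mg := measurable_int _ ig.
have igp := ge0_integrable_integral_kernel (g^\+) (funepos_ge0 g)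
  (integrable_funepos measurableT ig).
have ign := ge0_integrable_integral_kernel (g^\-) (funeneg_ge0 g)
  (integrable_funeneg measurableT ig).
rewrite integralE !ge0_integral_joint//; first last.
- exact: measurable_funepos.
- exact: measurable_funeneg.
(* The integrands agree at every [x]: an inner integral is by definition the difference of those of
   its two parts, so no null set has to be removed. *)
rewrite -integralB//; apply: eq_integral => x _ /=; rewrite [RHS]integralE.
by congr (_ - _); apply: eq_integral => y _; rewrite ?funeposE ?funenegE.
Qed.

Lemma integrable_integral_kernel (g : T * T -> \bar R) :
  m.-integrable setT g -> mu.-integrable setT (fun x => \int[P x]_y g (x, y)).
Proof.
move=> ig.
have igp := ge0_integrable_integral_kernel (g^\+) (funepos_ge0 g)
  (integrable_funepos measurableT ig).
have ign := ge0_integrable_integral_kernel (g^\-) (funeneg_ge0 g)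
  (integrable_funeneg measurableT ig).
apply: eq_integrable (integrableB measurableT igp ign) => // x _ /=.
rewrite [RHS]integralE.
by congr (_ - _); apply: eq_integral => y _; rewrite ?funeposE ?funenegE.
Qed.

Lemma integrable_joint_fst (g : T -> \bar R) :
  mu.-integrable setT g -> m.-integrable setT (g \o fst).
Proof.
move=> /integrableP[mg goo]; apply/integrableP; split.
  exact: measurableT_comp.
rewrite (ge0_integral_joint_fst mu P (abse \o g))//.
  exact: measurableT_comp.
by move=> x; exact: abse_ge0.
Qed.

Hypothesis invP : kernel_invariant mu P.

Lemma integrable_joint_snd (g : T -> \bar R) :
  mu.-integrable setT g -> m.-integrable setT (g \o snd).
Proof.
move=> /integrableP[mg goo]; apply/integrableP; split.
  exact: measurableT_comp.
rewrite (ge0_integral_joint_snd mu P invP (abse \o g))//.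
  exact: measurableT_comp.
by move=> x; exact: abse_ge0.
Qed.

(** Since (a - b)^2 / 2 = (a - b) a + (b^2 - a^2) / 2, the two integrands differ by a term whose
    integral vanishes, both marginals being [mu]. *)
Lemma dirichletE (f : T -> R) : measurable_fun setT f ->
  mu.-integrable setT (fun x => (f x ^+ 2)%:E) ->
  (dirichlet mu P f)%:E = \int[m]_z ((f z.1 - f z.2) ^+ 2 / 2)%:E.
Proof.
move=> mf if2.
have if1 : mu.-integrable setT (EFin \o f).
  (* Domination by |t| <= 1 + t^2, where the constant is integrable because [mu] is finite. *)
  apply: le_integrable (integrableD measurableT
    (finite_measure_integrable_cst mu 1%R measurableT) if2) => //=.
    exact/measurable_EFinP.
  move=> x _; rewrite lee_fin [leRHS]ger0_norm; last by nra.
  by rewrite ler_norml; apply/andP; split; nra.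
have i1 := integrable_joint_fst _ if2.
have i2 := integrable_joint_snd _ if2.
pose h (z : T * T) := (((f z.1 - f z.2) * f z.1)%R)%:E.
have mf1 : measurable_fun [set: T * T] (fun z => f z.1).
  exact: measurableT_comp.
have mf2 : measurable_fun [set: T * T] (fun z => f z.2).
  exact: measurableT_comp.
have ih : m.-integrable setT h.
  (* Domination by |(a - b) a| <= 2 a^2 + b^2. *)
  apply: le_integrable (integrableD measurableT
    (integrableZl measurableT 2 i1) i2) => //=.
    apply/measurable_EFinP; apply: measurable_funM => //.
    exact: measurable_funB.
  move=> z _; rewrite lee_fin [leRHS]ger0_norm; last by nra.
  by rewrite ler_norml; apply/andP; split; nra.
have if_snd := integrable_joint_snd _ if1.
have dE : (dirichlet mu P f)%:E = \int[m]_z h z.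
  rewrite -(fineK (integrable_fin_num measurableT ih)).
  rewrite /dirichlet; congr (fine _)%:E.
  rewrite integral_joint//; apply: ae_eq_integral => //.
  - apply/measurable_EFinP; apply: measurable_funM => //.
    apply: measurable_funB => //; apply: measurableT_comp => //.
    exact: (measurable_int _ (integrable_integral_kernel _ if_snd)).
  - exact: (measurable_int _ (integrable_integral_kernel _ ih)).
  (* [kapply P f x] is the junk value 0 where the integral is infinite, which
     happens only on a [mu]-null set since [f] is integrable and [mu] invariant. *)
  - have := integrable_ae measurableT (ge0_integrable_integral_kernel _
      (fun=> abse_ge0 _) (integrable_abse if_snd)).
    apply: filterS => x /(_ I)/= fin _.
    have iPx : (P x).-integrable setT (EFin \o f).
      apply/integrableP; split; first exact/measurable_EFinP.
      by rewrite -ge0_fin_numE ?integral_ge0.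
    have ic : (P x).-integrable setT (cst (f x)%:E).
      apply/integrableP; split; first exact: measurable_cst.
      rewrite (integral_cst (P x) measurableT `|(f x)%:E|) prob_kernel mule1.
      exact: ltry.
    have iB : (P x).-integrable setT (fun y => (f x)%:E - (f y)%:E).
      exact: integrableB.
    rewrite /h/=; under [RHS]eq_integral do rewrite EFinM EFinB.
    rewrite integralZr// integralB_EFin//.
    rewrite /kapply EFinM EFinB fineK; last exact: integrable_fin_num.
    congr ((_ - _) * _).
    have := integral_cst (P x) measurableT (f x)%:E.
    by rewrite prob_kernel mule1.
have ie : \int[m]_z (f z.2 ^+ 2)%:E = \int[m]_z (f z.1 ^+ 2)%:E.
  transitivity (\int[mu]_x (f x ^+ 2)%:E).
    apply: (ge0_integral_joint_snd mu P invP (fun x => (f x ^+ 2)%:E)) => //.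
    - exact: measurable_int if2.
    - by move=> x; rewrite lee_fin sqr_ge0.
  apply/esym/(ge0_integral_joint_fst mu P (fun x => (f x ^+ 2)%:E)) => //.
  - exact: measurable_int if2.
  - by move=> x; rewrite lee_fin sqr_ge0.
rewrite dE; transitivity (\int[m]_z
    (h z + 2^-1%:E * ((f z.2 ^+ 2)%:E - (f z.1 ^+ 2)%:E))).
  rewrite integralD//; last first.
    by apply: integrableZl => //; apply: integrableB.
  rewrite integralZl//; last exact: integrableB.
  rewrite integralB//= ie subee ?mule0 ?adde0//.
  exact: integrable_fin_num i1.
apply: eq_integral => z _; rewrite /h -EFinB -EFinM -EFinD; congr EFin.
by field.
Qed.

End dirichlet_form.

(** * From domination on sets to domination of integrals *)

Section density.
Context {d : measure_display} {T : measurableType d} {R : realType}.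
Variables (m1 m2 : {measure set T -> \bar R}) (D : set T) (e : T -> R).
Hypothesis me : measurable_fun [set: T] e.
Hypothesis e0 : forall x, (0 <= e x)%R.
Local Open Scope ereal_scope.
Hypothesis em : forall A, measurable A ->
  \int[m1]_(x in A `&` D) (e x)%:E <= m2 (A `&` D).

Import HBNNSimple.

(** By linearity it suffices to treat one level set at a time. A level set of a nonzero value lies
    inside [D], where [em] applies to it as it stands. *)
Let density_nnsfun (k : {nnsfun T >-> R}) : (forall x, ~ D x -> k x = 0%R) ->
  \int[m1]_x ((e x)%:E * (k x)%:E) <= \int[m2]_x (k x)%:E.
Proof.
move=> kD; rewrite integralT_nnsfun sintegralE.
rewrite (eq_integral (fun x => \sum_(r \in range k)
    ((e x)%:E * (r * \1_(k @^-1` [set r]) x)%:E))); last first.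
  move=> x _; rewrite fimfunE -fsumEFin// ge0_mule_fsumr// => r.
  exact: nnfun_muleindic_ge0.
rewrite ge0_integral_fsum//; last 2 first.
- move=> r; apply: emeasurable_funM; first exact/measurable_EFinP.
  exact/measurable_EFinP/measurable_funM.
- by move=> r x _; apply: mule_ge0; [rewrite lee_fin|exact: nnfun_muleindic_ge0].
apply: lee_fsum => // r _.
(* The level set of 0 may leave [D], where [em] gives no control, but the factor 0 cancels both
   sides. A negative value, treated below, has an empty level set. *)
have [->|r0] := eqVneq r 0%R.
  by rewrite mul0e integral0_eq// => x _; rewrite mul0r mule0.
have kr : k @^-1` [set r] `<=` D.
  by move=> x /= kx; apply: contrapT => /kD; rewrite kx; exact/eqP.
have [rn|rp] := ltP r 0%R.
  rewrite preimage_nnfun0// measure0 mule0 integral0_eq// => x _.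
  by rewrite indic0 mulr0 mule0.
under eq_integral do rewrite EFinM muleCA.
rewrite ge0_integralZl//; last 2 first.
- by apply: emeasurable_funM; exact/measurable_EFinP.
- by move=> x _; rewrite mule_ge0 ?lee_fin.
rewrite lee_pmul2l//; last by rewrite lte_fin lt0r r0.
have := em (k @^-1` [set r]) (measurable_funPTI k (measurable_set1 r)).
rewrite setIidl//; apply: le_trans.
by rewrite [leRHS]integral_mkcond (epatch_indic (EFin \o e)).
Qed.

(** Simple approximants satisfy 0 <= [g_ n] <= [g], so they also vanish off [D] and the simple case
    applies. Monotone convergence is used for [m1]; for [m2] the bound [g_ n] <= [g] is enough. *)
Lemma le_integral_density (g : T -> \bar R) : measurable_fun [set: T] g ->
  (forall x, 0 <= g x) -> (forall x, ~ D x -> g x = 0) ->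
  \int[m1]_x ((e x)%:E * g x) <= \int[m2]_x g x.
Proof.
move=> mg g0 gD; pose g_ := nnsfun_approx measurableT mg.
have g_cvg x : (g_ n x)%:E @[n --> \oo] --> g x by exact: cvg_nnsfun_approx.
have g_g n x : (g_ n x)%:E <= g x.
  by rewrite nnsfun_approxE; exact: le_approx.
have -> : \int[m1]_x ((e x)%:E * g x) =
    limn (fun n => \int[m1]_x ((e x)%:E * (g_ n x)%:E)).
  rewrite -monotone_convergence//; first last.
  - move=> x _ i j ij; rewrite lee_wpmul2l ?lee_fin//.
    exact/lefP/nd_nnsfun_approx.
  - by move=> n x _; rewrite mule_ge0 ?lee_fin.
  - by move=> n; apply: emeasurable_funM; exact/measurable_EFinP.
  apply: eq_integral => x _; apply/esym/cvg_lim => //.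
  exact: cvgeZl.
apply: lime_le.
  apply: ereal_nondecreasing_is_cvgn => i j ij; apply: ge0_le_integral => //.
  - by move=> x _; rewrite mule_ge0 ?lee_fin.
  - by apply: emeasurable_funM; exact/measurable_EFinP.
  - by apply: emeasurable_funM; exact/measurable_EFinP.
  - move=> x _; rewrite lee_wpmul2l ?lee_fin//.
    exact/lefP/nd_nnsfun_approx.
near=> n; apply: (@le_trans _ _ (\int[m2]_x (g_ n x)%:E)).
  apply: density_nnsfun => x /gD gx0; apply/eqP; rewrite eq_le fun_ge0 andbT.
  by rewrite -lee_fin -[leRHS]gx0 g_g.
apply: ge0_le_integral => //.
- by move=> x _; rewrite lee_fin.
- exact/measurable_EFinP.
Unshelve. all: by end_near. Qed.

End density.

(** If |b| <= |a|, the base is at most 2 a^2, and 2^p <= 4^p / 2 because p >= 1. The factor 1/2 on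
    the right compensates for the two terms, which have equal integrals under the joint law, so that
    the p-th root of 4^p leaves the constant 4. *)
Lemma half_sqrB_powR {R : realType} (a b p : R) : 1 <= p ->
  ((a - b) ^+ 2 / 2) `^ p <= 4 `^ p / 2 * (`|a| `^ (2 * p) + `|b| `^ (2 * p)).
Proof.
move=> p1; wlog ba : a b / `|b| <= `|a|.
  move=> H; have [/H//|/ltW/H] := leP `|b| `|a|.
  by rewrite (_ : (b - a) ^+ 2 = (a - b) ^+ 2) ?[`|b| `^ _ + _]addrC//; ring.
have p0 : 0 <= p by lra.
have h : (a - b) ^+ 2 / 2 <= 2 * `|a| ^+ 2.
  rewrite -[(a - b) ^+ 2]real_normK ?num_real//.
  by have := ler_normB a b; have := normr_ge0 (a - b); nra.
apply: (@le_trans _ _ ((2 * `|a| ^+ 2) `^ p)).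
  apply: ge0_ler_powR => //; rewrite nnegrE.
  - by rewrite divr_ge0 ?sqr_ge0.
  - by rewrite mulr_ge0 ?exprn_ge0.
rewrite powRM// ?exprn_ge0// -powR_mulrn// -powRrM.
have -> : 4 `^ p = 2 `^ p * 2 `^ p :> R.
  by rewrite -powRM//; congr (_ `^ _); ring.
have p2 : 2 <= 2 `^ p :> R by apply: le1r_powR => //; lra.
have t2 : 2 `^ p <= 2 `^ p * 2 `^ p / 2 :> R by nra.
rewrite ler_pM ?powR_ge0// lerDl.
exact: powR_ge0.
Qed.

(** * Bounds on the integral of [h] over a set, for finite and infinite exponents *)

Section joint_bounds.
Context {d : measure_display} {T : measurableType d} {R : realType}.
Variables (mu : probability T R) (P : R.-pker T ~> T) (f : T -> R).
Hypothesis invP : kernel_invariant mu P.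
Hypothesis mf : measurable_fun setT f.
Local Open Scope ereal_scope.
Local Notation m := (joint mu P).
Local Notation h := (fun z : T * T => ((f z.1 - f z.2) ^+ 2 / 2)%R).

Lemma measurable_half_sqrB : measurable_fun [set: T * T] h.
Proof.
apply: measurable_funM => //; apply: measurable_funX; apply: measurable_funB.
- exact: measurableT_comp.
- exact: measurableT_comp.
Qed.

Lemma Lnorm_half_sqrB (p : R) : (1 <= p)%R ->
  Lnorm mu (2 * p)%:E (EFin \o f) < +oo ->
  Lnorm m p%:E (EFin \o h) <=
  (4 * fine (Lnorm mu (2 * p)%:E (EFin \o f)) ^+ 2)%:E.
Proof.
move=> p1; have p0 : (0 < p)%R by lra.
(* The exponent 1/(2p) is nonzero, so finiteness of the norm gives finiteness of the integral [J]
   under the root. *)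
rewrite unlock => /lty_poweRy; rewrite invr_eq0 mulf_eq0 pnatr_eq0/=.
rewrite (gt_eqF p0) => /(_ isT).
have mfp : measurable_fun setT (fun x => (`|f x| `^ (2 * p))%R).
  apply: (measurableT_comp (f := (@powR R ^~ (2 * p)%R))) => //.
  exact: measurableT_comp.
set J := \int[mu]_x _ => Joo.
have J0 : 0 <= J by apply: integral_ge0 => x _; rewrite lee_fin powR_ge0.
have [j j0 Jj] : exists2 j : R, (0 <= j)%R & J = j%:E.
  by exists (fine J); rewrite ?fine_ge0 ?fineK ?ge0_fin_numE.
have hJ : \int[m]_z (`|(EFin \o h) z| `^ p) <= (4 `^ p)%:E * J.
  pose F z := (4 `^ p / 2)%:E * ((`|f z.1| `^ (2 * p))%:E +
     (`|f z.2| `^ (2 * p))%:E).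
  have F1 : measurable_fun [set: T * T] (fun z => (`|f z.1| `^ (2 * p))%:E).
    by apply/measurable_EFinP; exact: (measurableT_comp mfp).
  have F2 : measurable_fun [set: T * T] (fun z => (`|f z.2| `^ (2 * p))%:E).
    by apply/measurable_EFinP; exact: (measurableT_comp mfp).
  apply: (@le_trans _ _ (\int[m]_z F z)).
    apply: ge0_le_integral => //.
    - by move=> z _; exact: poweR_ge0.
    - apply: (measurableT_comp (measurable_poweR p)).
      apply: measurableT_comp => //.
      apply/measurable_EFinP; exact: measurable_half_sqrB.
    - by apply: measurable_funeM; exact: emeasurable_funD.
    - move=> z _; rewrite /F -EFinD -EFinM lee_fin ger0_norm; last first.
        by rewrite divr_ge0 ?sqr_ge0.
      exact: half_sqrB_powR.
  have a0 (x : R) : 0 <= (`|x| `^ (2 * p))%:E by rewrite lee_fin powR_ge0.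
  rewrite /F ge0_integralZl//; last 2 first.
  - exact: emeasurable_funD.
  - by move=> z _; rewrite adde_ge0.
  rewrite ge0_integralD//.
  rewrite (ge0_integral_joint_fst mu P (fun x => (`|f x| `^ (2 * p))%:E))//;
    last exact/measurable_EFinP.
  rewrite (ge0_integral_joint_snd mu P invP (fun x => (`|f x| `^ (2 * p))%:E))//;
    last exact/measurable_EFinP.
  rewrite -/J Jj -EFinD -!EFinM lee_fin.
  by rewrite le_eqVlt; apply/orP; left; apply/eqP; field.
apply: (@le_trans _ _ (((4 `^ p)%:E * J) `^ p^-1)).
  apply: gt0_ler_poweR => //; rewrite ?in_itv/= ?leey ?andbT.
  - by rewrite invr_ge0 ltW.
  - by apply: integral_ge0 => z _; rewrite lee_fin powR_ge0.
  - by rewrite mule_ge0 ?lee_fin ?powR_ge0.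
rewrite Jj -EFinM !poweR_EFin lee_fin /=.
(* The p-th root turns 4^p j into 4 j^(1/p), and j^(1/p) is the square of j^(1/(2p)), the norm of
   [f]. *)
rewrite powRM ?powR_ge0 ?fine_ge0// -powRrM divff ?gt_eqF// powRr1//.
by rewrite -powR_mulrn ?powR_ge0// -powRrM invfM mulrAC mulVf// mul1r.
Qed.

(** Hoelder's inequality for the product of [h] and the indicator of [B], whose norm of exponent [q]
    is the mass of [B] to the power 1/q. *)
Lemma le_integral_half_sqrB (p q : R) (B : set (T * T)) : measurable B ->
  (1 < p)%R -> (0 < q)%R -> (p^-1 + q^-1 = 1)%R ->
  Lnorm mu (2 * p)%:E (EFin \o f) < +oo ->
  \int[m]_z (h z * \1_B z)%:E <=
  m B `^ q^-1 * (4 * fine (Lnorm mu (2 * p)%:E (EFin \o f)) ^+ 2)%:E.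
Proof.
move=> mB p1 q0 pq foo.
have -> : \int[m]_z (h z * \1_B z)%:E = Lnorm m 1 (EFin \o (h \* \1_B)%R).
  rewrite Lnorm1; apply: eq_integral => z _ /=.
  by rewrite ger0_norm// mulr_ge0 ?divr_ge0 ?sqr_ge0.
apply: le_trans (hoelder m measurable_half_sqrB (measurable_indic mB)
  (lt_trans ltr01 p1) q0 pq) _.
have -> : Lnorm m q%:E (EFin \o \1_B) = m B `^ q^-1.
  rewrite unlock -[X in m X]setIT -integral_indic//; congr (_ `^ _).
  apply: eq_integral => z _ /=; rewrite indicE.
  (* An indicator is its own power of exponent [q]; off [B] this relies on [q] being nonzero, as 0
     to the power 0 is 1. *)
  by case: (z \in B); rewrite ?normr1 ?powR1 ?normr0 ?powR0 ?gt_eqF.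
rewrite muleC lee_wpmul2l ?poweR_ge0//; exact: Lnorm_half_sqrB (ltW p1) foo.
Qed.

(** The cylinder over a [mu]-null set is null for the joint law, its mass being read off the
    marginal. This and its twin carry the essential bounds of [f] to both coordinates. *)
Lemma ae_joint_fst (Q : T -> Prop) :
  (\forall x \ae mu, Q x) -> \forall z \ae m, Q z.1.
Proof.
move=> [N [mN N0 subN]]; exists (fst @^-1` N).
have mfN : measurable (fst @^-1` N : set (T * T)).
  by rewrite -[X in measurable X]setTI; exact: measurable_fst.
split=> //; last by move=> z /= Qz; exact: subN.
rewrite -[X in m X]setIT -integral_indic//.
rewrite -N0 -[X in mu X]setIT -integral_indic//.
apply: (ge0_integral_joint_fst mu P (fun x => (\1_N x)%:E)).
- exact/measurable_EFinP.
- by move=> x; rewrite lee_fin.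
Qed.

Lemma ae_joint_snd (Q : T -> Prop) :
  (\forall x \ae mu, Q x) -> \forall z \ae m, Q z.2.
Proof.
move=> [N [mN N0 subN]]; exists (snd @^-1` N).
have mfN : measurable (snd @^-1` N : set (T * T)).
  by rewrite -[X in measurable X]setTI; exact: measurable_snd.
split=> //; last by move=> z /= Qz; exact: subN.
rewrite -[X in m X]setIT -integral_indic//.
rewrite -N0 -[X in mu X]setIT -integral_indic//.
apply: (ge0_integral_joint_snd mu P invP (fun x => (\1_N x)%:E)).
- exact/measurable_EFinP.
- by move=> x; rewrite lee_fin.
Qed.

(** Almost surely both f(X) and f(Y) lie between the essential bounds of [f], so [h] is at most half
    the squared oscillation; the factor 1/2 is given away. *)
Lemma le_integral_half_sqrB_osc (B : set (T * T)) : measurable B ->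
  Lnorm mu +oo (EFin \o f) < +oo ->
  \int[m]_z (h z * \1_B z)%:E <= m B *
   (fine (ess_sup mu (EFin \o f) - ess_inf mu (EFin \o f)) ^+ 2)%:E.
Proof.
move=> mB; rewrite unlock.
(* The norm at infinity is defined by cases on whether the total mass is positive. *)
have muT : 0 < mu setT by rewrite probability_setT.
rewrite muT => foo; set c := ess_sup _ _ in foo.
have c0 : 0 <= c by apply: ess_sup_gee => //; apply: nearW => x; exact: abse_ge0.
have cfin : c \is a fin_num by rewrite ge0_fin_numE.
have fc : \forall x \ae mu, `|(f x)%:E| <= c by exact: ess_sup_ge.
have fcl : \forall x \ae mu, - c <= (f x)%:E.
  by apply: filterS fc => x; rewrite -(fineK cfin) !lee_fin ler_norml => /andP[].
have fcr : \forall x \ae mu, (f x)%:E <= c.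
  by apply: filterS fc => x; apply: le_trans; rewrite lee_fin ler_norm.
(* Both essential bounds lie in [-c, c], so [fine] returns the true oscillation and not its default
   value. *)
have [a af] : exists a, ess_sup mu (EFin \o f) = a%:E.
  exists (fine (ess_sup mu (EFin \o f))); rewrite fineK// fin_numElt.
  apply/andP; split.
    apply: (@lt_le_trans _ _ (- c)); first by rewrite ltNye_eq fin_numN cfin.
    exact: ess_sup_gee.
  by apply: le_lt_trans foo; apply/ess_supP.
have [b bf] : exists b, ess_inf mu (EFin \o f) = b%:E.
  exists (fine (ess_inf mu (EFin \o f))); rewrite fineK// fin_numElt.
  apply/andP; split.
    apply: (@lt_le_trans _ _ (- c)); first by rewrite ltNye_eq fin_numN cfin.
    exact/ess_infP.
  by apply: le_lt_trans foo; rewrite -(ess_inf_cst c muT); exact: le_ess_inf.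
rewrite af bf /=.
have fa : \forall x \ae mu, (f x <= a)%R.
  by have := ess_sup_ge mu (EFin \o f); rewrite af; apply: filterS.
have fb : \forall x \ae mu, (b <= f x)%R.
  by have := ess_inf_le mu (EFin \o f); rewrite bf; apply: filterS.
have mh := measurable_half_sqrB.
rewrite muleC -[X in m X]setIT -integral_indic// -ge0_integralZl//; last 2 first.
- exact/measurable_EFinP.
- by rewrite lee_fin sqr_ge0.
apply: ae_ge0_le_integral => //.
- by move=> z _; rewrite lee_fin mulr_ge0 ?divr_ge0 ?sqr_ge0.
- exact/measurable_EFinP/measurable_funM.
- by move=> z _; rewrite mule_ge0 ?lee_fin ?sqr_ge0.
- exact/measurable_funeM/measurable_EFinP.
near=> z; move=> _; rewrite -EFinM lee_fin ler_wpM2r//.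
have za : (f z.1 <= a)%R.
  by near: z; exact: (ae_joint_fst (fun x => (f x <= a)%R)).
have zb : (b <= f z.1)%R.
  by near: z; exact: (ae_joint_fst (fun x => (b <= f x)%R)).
have za2 : (f z.2 <= a)%R.
  by near: z; exact: (ae_joint_snd (fun x => (f x <= a)%R)).
have zb2 : (b <= f z.2)%R.
  by near: z; exact: (ae_joint_snd (fun x => (b <= f x)%R)).
by nra.
Unshelve. all: by end_near. Qed.

End joint_bounds.

(** * Comparison of the two Dirichlet forms *)

Theorem theorem36 (d : measure_display) (T : measurableType d) (R : realType)
  (mu : probability T R) (P1 P2 : R.-pker T ~> T)
  (eps : T * T -> R)
  (hdiag : measurable [set xy : T * T | xy.1 = xy.2])
  (hinv1 : kernel_invariant mu P1) (hinv2 : kernel_invariant mu P2)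
  (heps_meas : measurable_fun setT eps)
  (heps_pos : forall xy, 0 < eps xy)
  (hdom : forall (x : T) (A : set T), measurable A ->
     (\int[P1 x]_(y in A `\ x) (eps (x, y))%:E <= P2 x (A `\ x))%E)
  (p : \bar R) (q : R)
  (hp : (1%:E < p)%E) (hq : 1 <= q)
  (hpq : (p = +oo%E /\ q = 1) \/
         (exists p' : R, p = p'%:E /\ p'^-1 + q^-1 = 1))
  (s : R) (hs : 0 < s) (f : T -> R)
  (hf : L0space mu (2%:E * p)%E f) :
  dirichlet mu P1 f <=
    s * dirichlet mu P2 f
    + (fine (mu_otimes mu P1
          (~` [set xy : T * T | s * eps xy > 1] `&` [set xy | xy.1 <> xy.2])))
        `^ q^-1 * Phi mu p f.
Proof.
have [mf [foo _]] := hf.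
have mh := measurable_half_sqrB f mf.
set h := fun z : T * T => (f z.1 - f z.2) ^+ 2 / 2 in mh.
have h0 z : 0 <= h z by rewrite divr_ge0 ?sqr_ge0.
set B := _ `&` _.
have mB : measurable B.
  (* The diagonal of an abstract measurable space may fail to be measurable; [hdiag] supplies
     this. *)
  apply: measurableI; apply: measurableC => //.
  have ms : measurable_fun [set: T * T] (fun z => s * eps z).
    exact: measurable_funM.
  rewrite (_ : mkset _ = setT `&` (fun z => s * eps z) @^-1` `]1, +oo[).
    exact: ms.
  by apply/seteqP; split=> z /=; rewrite in_itv/= andbT// => -[].
(* Since 2 <= 2p and [mu] is finite, [f] is square integrable, as the symmetrised form requires. *)
have p2 : (2%:E <= 2%:E * p)%E by rewrite lee_pemulr// ltW.
have if2 : mu.-integrable setT (fun x => (f x ^+ 2)%:E).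
  apply: Lfun2_integrable_sqr.
  apply: (@Lfun_subset _ _ _ mu 2%:E (2%:E * p)%E) => //.
  - by rewrite lee1n.
  - by apply: le_trans p2; rewrite lee1n.
  - exact: fin_num_measure.
  - by rewrite inE; apply/andP; split; rewrite inE.
have E1 : ((dirichlet mu P1 f)%:E = \int[joint mu P1]_z (h z)%:E)%E.
  exact: dirichletE.
have E2 : ((dirichlet mu P2 f)%:E = \int[joint mu P2]_z (h z)%:E)%E.
  exact: dirichletE.
have mBE : mu_otimes mu P1 B = joint mu P1 B.
  rewrite joint_xsection//; apply: eq_integral => x _; rewrite xsectionE//.
have mBfin : joint mu P1 B \is a fin_num.
  rewrite ge0_fin_numE//; apply: (@le_lt_trans _ _ 1%E); last exact: ltry.
  rewrite joint_xsection//.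
  apply: (@le_trans _ _ (\int[mu]_x 1)%E).
    apply: ge0_le_integral => //.
    - by apply: measurable_fun_xsection_finite_kernel; rewrite inE.
    - move=> x _; rewrite -(@prob_kernel _ _ _ _ _ P1 x) le_measure ?inE//.
      exact: measurable_xsection.
  by rewrite integral_cst// mul1e; exact: probability_le1.
have hB : (\int[joint mu P1]_z (h z * \1_B z)%:E <=
    (fine (joint mu P1 B) `^ q^-1 * Phi mu p f)%:E)%E.
  rewrite EFinM -poweR_EFin fineK//.
  (* When [p] is infinite, [q] is 1 and the power of the mass is the mass itself. *)
  case: hpq => [[pE qE]|[p' [pE pq]]].
    rewrite qE invr1 poweRe1// pE.
    apply: le_integral_half_sqrB_osc => //.
    by move: foo; rewrite pE gt0_muley// lte_fin.
  move: hp foo; rewrite pE lte_fin => p1 foo.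
  apply: le_integral_half_sqrB => //; lra.
have mhe : measurable_fun [set: T * T] (fun z => (h z)%:E).
  exact/measurable_EFinP.
have he0 z : (0 <= (h z)%:E)%E by rewrite lee_fin.
have meps : measurable_fun [set: T * T] (fun z => (eps z)%:E * (h z)%:E)%E.
  by apply: emeasurable_funM => //; exact/measurable_EFinP.
have eps0 z : (0 <= (eps z)%:E * (h z)%:E)%E.
  by rewrite mule_ge0 ?lee_fin// ltW.
have mhB : measurable_fun [set: T * T] (fun z => (h z * \1_B z)%:E).
  exact/measurable_EFinP/measurable_funM.
have hB0 z : (0 <= (h z * \1_B z)%:E)%E by rewrite lee_fin mulr_ge0.
have mseps : measurable_fun [set: T * T]
    (fun z => s%:E * ((eps z)%:E * (h z)%:E))%E.
  exact: measurable_funeM.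
have seps0 z : (0 <= s%:E * ((eps z)%:E * (h z)%:E))%E.
  by apply: mule_ge0 => //; rewrite lee_fin ltW.
have heps : (\int[joint mu P1]_z ((eps z)%:E * (h z)%:E) <=
    \int[joint mu P2]_z (h z)%:E)%E.
  rewrite !ge0_integral_joint//.
  apply: ge0_le_integral => //.
  - by move=> x _; exact: integral_ge0.
  - exact: (measurable_fun_integral_finite_kernel
      (fun z => (eps z)%:E * (h z)%:E)%E).
  - exact: (measurable_fun_integral_finite_kernel (fun z => (h z)%:E)).
  move=> x _.
  (* On each fibre [D] is the complement of {x}: intersecting with it removes the point [x], which
     is the form of [hdom], and [h] vanishes at (x, x). *)
  apply: (le_integral_density (P1 x) (P2 x) (~` [set x]) (fun y => eps (x, y))
    _ _ _ (fun y => (h (x, y))%:E)).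
  - exact: (measurable_fun_pair2 (f := eps)).
  - by move=> y; exact: ltW.
  - by move=> A mA; exact: hdom.
  - exact: (measurable_fun_pair2 (f := fun z => (h z)%:E)).
  - by move=> y; rewrite lee_fin.
  - by move=> y /= /contrapT ->; rewrite /h/= subrr expr0n/= mul0r.
rewrite mBE -lee_fin EFinD EFinM E1 E2.
(* Pointwise [h <= s eps h + h 1_B]: off [B] either [s eps > 1] or [h = 0]. *)
apply: (@le_trans _ _ (\int[joint mu P1]_z
    (s%:E * ((eps z)%:E * (h z)%:E) + (h z * \1_B z)%:E))%E).
  apply: ge0_le_integral => //.
  - exact: emeasurable_funD.
  - move=> z _; rewrite -!EFinM -EFinD lee_fin -/(h z).
    have [Bz|nBz] := boolP (z \in B).
      rewrite indicE Bz mulr1 lerDr.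
      exact: seps0.
    rewrite indicE (negbTE nBz) mulr0 addr0.
    have [z12|z12] := pselect (z.1 = z.2).
      by rewrite /h z12 subrr expr0n/= mul0r !mulr0.
    have sz : 1 < s * eps z.
      by apply: contrapT => sz; move/negP: nBz; apply; rewrite inE.
    by rewrite mulrA -[leLHS]mul1r ler_wpM2r// ltW.
rewrite ge0_integralD// ge0_integralZl//; last by rewrite lee_fin ltW.
have s0 : (0 <= s%:E)%E by rewrite lee_fin ltW.
exact: leeD (lee_wpmul2l s0 heps) hB.
Qed.
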